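(* Assume $\mathfrak c\leq\omega_2$. Then there is a countable Hausdorff 0-dimensional Fréchet-Urysohn space that is not H-separable and has $\pi$-weight $\mathfrak b$.
   Context: A space is 0-dimensional if it has a base consisting of clopen sets. A space $X$ is Fréchet-Urysohn if for every $A\subset X$ and $x\in\overline{A}\setminus A$ there is a sequence $S\subset A$ converging to $x$. A space $X$ is H-separable if for every sequence $\{D_n : n\in\omega\}$ of dense subsets of $X$ there is a selection of finite sets $F_n\subset D_n$ ($n\in\omega$) such that for every infinite $A\subset\omega$ the set $\bigcup\{F_n : n\in A\}$ is dense in $X$. The $\pi$-weight of $X$ is the least cardinality of a $\pi$-base, i.e. of a family of nonempty open sets such that every nonempty open set contains a member of the family. $\mathfrak c=2^{\aleph_0}$, and $\mathfrak b$ is the least cardinality of a subset of $\omega^\omega$ that is unbounded with respect to the mod finite order $<^*$. *)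

(* Defs.v *)
From HB Require Import structures.
From mathcomp Require Import all_boot all_order all_algebra.
From mathcomp Require Import all_classical all_reals all_analysis.

Set Implicit Arguments.
Unset Strict Implicit.
Unset Printing Implicit Defensive.

Local Open Scope classical_set_scope.
Local Open Scope card_scope.

(* Cardinal numbers are represented by arbitrary types of that cardinality. *)

Definition card_lt (K L : Type) : Prop :=
  ([set: K] #<= [set: L]) /\ ~ ([set: L] #<= [set: K]).

Definition is_successor_cardinal (K L : Type) : Prop :=
  card_lt K L /\ forall M : Type, card_lt K M -> [set: L] #<= [set: M].

Definition is_least_cardinality (T : Type) (P : set (set T)) (K : Type) : Prop :=
  (exists2 A : set T, P A & A #= [set: K]) /\
  (forall A : set T, P A -> [set: K] #<= A).

Definition lt_mod_finite (f g : nat -> nat) : Prop :=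
  \forall n \near \oo, (f n < g n)%N.

Definition unbounded_family (B : set (nat -> nat)) : Prop :=
  ~ exists g : nat -> nat, forall f, B f -> lt_mod_finite f g.

Definition is_bounding_number (K : Type) : Prop :=
  is_least_cardinality unbounded_family K.

(* Not the library's [zero_dimensional], which only asks that distinct points
   be separated by clopen sets. *)
Definition has_clopen_base (X : topologicalType) : Prop :=
  exists2 B : set (set X), basis B & B `<=` clopen.

Definition frechet_urysohn (X : topologicalType) : Prop :=
  forall (A : set X) (x : X), (closure A `\` A) x ->
    exists2 u : nat -> X, (forall n, A (u n)) & u @ \oo --> x.

Definition H_separable (X : topologicalType) : Prop :=
  forall D : nat -> set X, (forall n, dense (D n)) ->
    exists F : nat -> set X,
      (forall n, finite_set (F n) /\ F n `<=` D n) /\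
      (forall A : set nat, infinite_set A -> dense (\bigcup_(n in A) F n)).

Definition pi_base (X : topologicalType) (P : set (set X)) : Prop :=
  (forall U, P U -> open U /\ U !=set0) /\
  (forall O : set X, open O -> O !=set0 -> exists2 U, P U & U `<=` O).

Definition is_pi_weight (X : topologicalType) (K : Type) : Prop :=
  is_least_cardinality (@pi_base X) K.

(* Main.v *)
(** The space is [nat] with its 2-adic topology, refined by clopen sets. The
   columns [col = n] are dense, and for every [g] some clopen set misses, for
   infinitely many [n], the points below [g n] of the column [n]; this defeats
   H-separability, hence also gives pi-weight at least b.

   Sequences promised to converge to a point lie almost inside a funnel around
   it, and fewer than b of them are controlled by the funnels of a single
   function. Funnels around distinct points being almost disjoint, they form a
   forest, so any point outside a set [B] can be separated from [B] by a set
   that is compatible with every promise not clashing with [B].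

   Under c <= omega_2 either b = omega_1 or b = c. If b = c, all pairs (A, x)
   are treated in a recursion of length b: either a sequence of A converges to
   x so far and its convergence is promised, or x is separated from A by a new
   clopen set; domination makes sequential closure idempotent, which is what
   the separation needs. If b = omega_1, the promises are read off an unbounded
   tower of subsets of [nat], the k-th clopen set respecting only the promises
   up to k; the Frechet-Urysohn property follows by the diagonal argument of
   Galvin-Miller and Orenshtein-Tsaban for gamma-sets. *)

Require Import Defs.
From HB Require Import structures.
From mathcomp Require Import all_boot all_order all_algebra.
From mathcomp Require Import all_classical all_reals all_analysis.
From mathcomp Require Import wochoice zify.

Local Open Scope classical_set_scope.
Local Open Scope card_scope.

Set Implicit Arguments.
Unset Strict Implicit.
Unset Printing Implicit Defensive.

(** * Funnels and separation *)

Definition cong (k x y : nat) : Prop := x = y %[mod 2 ^ k].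

Lemma cong_le (k l x y : nat) : (k <= l)%N -> cong l x y -> cong k x y.
Proof.
move=> kl; rewrite /cong => e.
by rewrite -(modn_dvdm x (dvdn_exp2l 2 kl)) e modn_dvdm // dvdn_exp2l.
Qed.

Lemma cong_trans (k x y z : nat) : cong k x y -> cong k y z -> cong k x z.
Proof. exact: etrans. Qed.

Lemma cong_sep (x y : nat) : x <> y -> exists k, ~ cong k x y.
Proof.
move=> xy; exists (x + y); rewrite /cong !modn_small //.
  by apply: leq_ltn_trans (ltn_expl _ _) => //; rewrite leq_addl.
by apply: leq_ltn_trans (ltn_expl _ _) => //; rewrite leq_addr.
Qed.

Definition col (y : nat) : nat := logn 2 (trunc_log 2 y).

(* The binary length of [y] is independent of its low-order digits. *)
Lemma col_dense (n x k : nat) : exists y, [/\ (k <= y)%N, cong k x y & col y = n].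
Proof.
(* [l] exceeds [k] and has 2-adic valuation [n]: a leading digit at place [l] puts [y] in column [n]
   and leaves the last [k] digits free. *)
pose l := (2 ^ n * (2 * k).+1)%N.
have kl : (k < l)%N.
  by rewrite /l; have : (0 < 2 ^ n)%N by [rewrite expn_gt0]; nia.
have x2 : (x %% 2 ^ k < 2 ^ l)%N.
  by apply: (@ltn_trans (2 ^ k)); rewrite ?ltn_mod ?expn_gt0 // ltn_exp2l.
exists (2 ^ l + x %% 2 ^ k)%N; split.
- by apply: leq_trans (leq_addr _ _); apply/ltnW/(ltn_trans kl)/ltn_expl.
- rewrite /cong -modnDm modn_mod.
  by rewrite (eqP (dvdn_exp2l 2 (ltnW kl))) add0n modn_mod.
- rewrite /col (@trunc_log_eq 2 l) //; last first.
    by rewrite leq_addr expnS mul2n -addnn ltn_add2l.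
  rewrite lognM ?expn_gt0 // pfactorK // logn_coprime ?addn0 //.
  by rewrite coprime2n /= oddM.
Qed.

Lemma cong_large (x y i : nat) : cong (x + i) x y -> x <> y -> (i <= y)%N.
Proof.
move=> xy nxy; rewrite leqNgt; apply/negP => yi; apply: nxy.
move: xy; rewrite /cong !modn_small //.
  by apply: leq_ltn_trans (ltn_expl _ _) => //; rewrite (leq_trans (ltnW yi)) // leq_addl.
by apply: leq_ltn_trans (ltn_expl _ _) => //; rewrite leq_addr.
Qed.

(** Every clopen set added later respects these sequences, which keeps each column dense. *)
Lemma col_sequence : exists q : nat -> nat -> nat -> nat, forall n x i,
  [/\ (i <= q n x i)%N, cong i x (q n x i) & col (q n x i) = n].
Proof.
have /choice[q qP] : forall p : nat * nat * nat, exists y,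
    [/\ (p.2 <= y)%N, cong p.2 p.1.2 y & col y = p.1.1].
  by move=> [[n x] i]; apply: col_dense.
by exists (fun n x i => q (n, x, i)) => n x i; apply: (qP (n, x, i)).
Qed.

Lemma nearP (P : nat -> Prop) :
  (\forall z \near \oo, P z) <-> exists N, forall z, (N <= z)%N -> P z.
Proof.
split=> [[N _ PN]|[N PN]]; first by exists N => z; apply: PN.
by exists N => // z; apply: PN.
Qed.

Lemma not_nearP (P : nat -> Prop) :
  ~ (\forall z \near \oo, P z) -> forall N, exists2 z, (N <= z)%N & ~ P z.
Proof.
move=> nP N; apply: contrapT => H; apply: nP; apply/nearP; exists N => z Nz.
by apply: contrapT => nPz; apply: H; exists z.
Qed.

Lemma near_forall_lt (n : nat) (P : nat -> nat -> Prop) :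
  (forall i, (i < n)%N -> \forall z \near \oo, P i z) ->
  \forall z \near \oo, forall i, (i < n)%N -> P i z.
Proof.
elim: n => [|n IH] H; first by near=> z => i.
have /nearP[N HN] := IH (fun i Hi => H i (ltnW Hi)).
have /nearP[M HM] := H n (ltnSn n).
apply/nearP; exists (maxn N M) => z; rewrite geq_max => /andP[Nz Mz] i.
by rewrite ltnS leq_eqVlt => /orP[/eqP ->|ltin]; [apply: HM|apply: HN].
Unshelve. all: by end_near. Qed.

(** A sequence [u] with [cong i x (u i)] lies in the funnel of [x] given by [f i = (u i).+1], so [f]
    measures the speed of 2-adic convergence. *)
Definition funnel (f : nat -> nat) (x : nat) : set nat :=
  [set z | exists2 k, cong k x z & (z < f k)%N].

Lemma near_ge_values (f : nat -> nat) (n : nat) :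
  \forall z \near \oo, forall k, (k < n)%N -> (f k <= z)%N.
Proof.
by apply: near_forall_lt => k _; apply/nearP; exists (f k).
Qed.

(** The finitely many precisions [k] at which [g] may fail to be below [f] serve only points below
    some [g k]. *)
Lemma funnel_mod (f g : nat -> nat) (x : nat) : lt_mod_finite g f ->
  \forall z \near \oo, funnel g x z -> funnel f x z.
Proof.
move=> /nearP[N gf]; have /nearP[M HM] := near_ge_values g N.
apply/nearP; exists M => z Mz [k xz zk]; exists k => //.
apply: ltn_trans (gf k _) => //; rewrite leqNgt; apply/negP => kN.
by have := HM z Mz k kN; rewrite leqNgt zk.
Qed.

Lemma funnel_cong (f : nat -> nat) (x k : nat) :
  \forall z \near \oo, funnel f x z -> cong k x z.
Proof.
have /nearP[M HM] := near_ge_values f k.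
apply/nearP; exists M => z Mz [l xz zl]; apply: cong_le xz.
rewrite leqNgt; apply/negP => lk.
by have := HM z Mz l lk; rewrite leqNgt zl.
Qed.

Lemma funnel_disjoint (f : nat -> nat) (x y : nat) : x <> y ->
  \forall z \near \oo, funnel f x z -> ~ funnel f y z.
Proof.
move=> /cong_sep[k nxy].
have /nearP[M HM] := funnel_cong f x k; have /nearP[N HN] := funnel_cong f y k.
apply/nearP; exists (maxn N M) => z; rewrite geq_max => /andP[Nz Mz] fx fy.
by apply: nxy; apply: cong_trans (HM z Mz fx) _; apply/esym/HN.
Qed.

Section separation.
Variables (f : nat -> nat) (B : set nat) (x0 : nat).

(* Attaching each point to the least [y] whose funnel contains it turns the
   funnels into the edges of a forest on [nat]. *)
Let child (y z : nat) : Prop := funnel f y z /\ (B z -> B y).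
Let parent (y z : nat) : Prop :=
  child y z /\ forall y', (y' < y)%N -> ~ child y' z.

Inductive offspring : nat -> Prop :=
| offspring_root : offspring x0
| offspring_step y z : parent y z -> ~ B z -> offspring y -> offspring z.

Lemma parent_unique (y y' z : nat) : parent y z -> parent y' z -> y = y'.
Proof.
move=> [yz miny] [y'z miny'].
by case: (ltngtP y y') => // [/miny'|/miny].
Qed.

(** [U] consists of the descendants of [x0] along paths avoiding [B]. Almost all points of [S] have
    parent [y]; if [y] is in [U], it is not in [B], so almost all of them avoid [B] and join [U]. *)
Lemma separation : ~ B x0 -> exists U : set nat,
  [/\ U x0, forall z, B z -> ~ U z &
  forall (y : nat) (S : set nat),
    (\forall z \near \oo, S z -> funnel f y z) ->
    (~ B y -> \forall z \near \oo, S z -> ~ B z) ->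
    \forall z \near \oo, S z -> (U z <-> U y)].
Proof.
move=> nBx0.
have offB z : offspring z -> ~ B z by case.
exists offspring; split=> [|z Bz /offB //|y S Sy SB].
  exact: offspring_root.
have {}SB : \forall z \near \oo, S z -> B z -> B y.
  have [By|/SB] := pselect (B y); first by near=> z.
  by apply: filterS => z SB' /SB' nBz /nBz.
(* Only finitely many [y'] lie below [y], and their funnels almost miss that of [y]. Beyond the root
   [x0], a point enters [U] only through its parent. *)
have Pz : \forall z \near \oo, S z -> parent y z /\ (x0 < z)%N.
  have H : \forall z \near \oo, forall y', (y' < y)%N ->
      funnel f y z -> ~ funnel f y' z.
    apply: near_forall_lt => y' y'y; apply: funnel_disjoint => e.
    by rewrite e ltnn in y'y.
  near=> z => Sz.
  have yz : funnel f y z by apply: (near Sy z).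
  split; last by near: z; exact: nbhs_infty_gt.
  split; first by split=> // Bz; apply: (near SB z).
  by move=> y' y'y [y'z _]; apply: (near H z _ y').
near=> z => Sz.
have [pyz x0z] : parent y z /\ (x0 < z)%N by apply: (near Pz z).
split=> [Uz|Uy].
  case: Uz pyz x0z => [|y' z' py'z' _ Uy'] pyz; first by rewrite ltnn.
  by rewrite (parent_unique pyz py'z').
apply: (offspring_step pyz _ Uy) => Bz.
by apply: (offB _ Uy); apply: (near SB z).
Unshelve. all: by end_near. Qed.

End separation.

(** * The topology generated by a family of clopen sets *)

Lemma finite_nat_bounded (A : set nat) :
  finite_set A -> exists N, forall y, A y -> (y < N)%N.
Proof.
move=> /finite_fsetP[Z ->]; exists (\sum_(z <- finmap.enum_fset Z) z).+1.
move=> y /= yZ; rewrite ltnS (big_rem y) //=; exact: leq_addr.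
Qed.

Lemma unbounded_infinite (A : set nat) :
  (forall N, exists2 n, (N <= n)%N & A n) -> infinite_set A.
Proof.
move=> H /finite_nat_bounded[N AN]; have [n Nn /AN] := H N.
by rewrite ltnNge Nn.
Qed.

Section generated_topology.
Variables (J : Type) (C : J -> set nat).

(** Agreement is asked in both directions, so cells are the classes of an equivalence relation and
    therefore clopen. *)
Definition cell (s : nat * seq J) (x : nat) : set nat :=
  [set y | cong s.1 x y /\ List.Forall (fun j => C j x <-> C j y) s.2].

Lemma cell_refl (s : nat * seq J) (x : nat) : cell s x x.
Proof. by split=> //; apply/List.Forall_forall. Qed.

Lemma cell_sym (s : nat * seq J) (x y : nat) : cell s x y -> cell s y x.
Proof.
by case=> xy H; split=> //; apply: List.Forall_impl H => j; apply: iff_sym.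
Qed.

Lemma cell_trans (s : nat * seq J) (x y z : nat) :
  cell s x y -> cell s y z -> cell s x z.
Proof.
case=> xy /List.Forall_forall H [yz /List.Forall_forall K].
split; first exact: cong_trans yz.
by apply/List.Forall_forall => j js; apply: iff_trans (H j js) (K j js).
Qed.

Lemma cell_eq (s : nat * seq J) (x y : nat) : cell s x y -> cell s x = cell s y.
Proof.
move=> xy; apply/seteqP; split=> z; apply: cell_trans => //.
exact: cell_sym.
Qed.

Lemma cell_capl (s t : nat * seq J) (x : nat) :
  cell (maxn s.1 t.1, s.2 ++ t.2) x `<=` cell s x.
Proof.
move=> y [/= xy /List.Forall_app[H _]]; split=> //.
by apply: cong_le xy; rewrite leq_maxl.
Qed.

Lemma cell_capr (s t : nat * seq J) (x : nat) :
  cell (maxn s.1 t.1, s.2 ++ t.2) x `<=` cell t x.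
Proof.
move=> y [/= xy /List.Forall_app[_ H]]; split=> //.
by apply: cong_le xy; rewrite leq_maxr.
Qed.

Lemma near_cell (u : nat -> nat) (x : nat) :
  (forall i, cong i x (u i)) ->
  (forall j, \forall i \near \oo, C j (u i) <-> C j x) ->
  forall s, \forall i \near \oo, cell s x (u i).
Proof.
move=> xu Cu [k l]; elim: l => [|j l IH].
  by apply/nearP; exists k => i ki; split; [apply: cong_le (xu i)|constructor].
apply: filterS2 IH (Cu j) => i [xui H] e; split=> //=.
by constructor => //; apply: iff_sym.
Qed.

Definition cell_open (O : set nat) : Prop :=
  forall x, O x -> exists s, cell s x `<=` O.

Lemma cell_openT : cell_open setT.
Proof. by move=> x _; exists (0%N, [::]). Qed.

Lemma cell_openI : setI_closed cell_open.
Proof.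
move=> O P Oo Po x [/Oo[s sO] /Po[t tP]].
exists (maxn s.1 t.1, s.2 ++ t.2) => y y_st.
by split; [apply: sO; exact: cell_capl y_st|apply: tP; exact: cell_capr y_st].
Qed.

Lemma cell_open_bigcup (I : Type) (F : I -> set nat) :
  (forall i, cell_open (F i)) -> cell_open (\bigcup_i F i).
Proof.
move=> Fo x [i _ /Fo[s sF]]; exists s => y /sF Fy.
by exists i.
Qed.

(* The phantom argument lets canonical structures find the topology. *)
Definition cell_space (F : J -> set nat) : Type := nat.

HB.instance Definition _ := Choice.on (cell_space C).
HB.instance Definition _ :=
  isOpenTopological.Build (cell_space C) cell_openT cell_openI cell_open_bigcup.

Lemma open_cellE (O : set (cell_space C)) : open O = cell_open O.
Proof. by []. Qed.

Lemma open_cell (s : nat * seq J) (x : nat) : open (cell s x : set (cell_space C)).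
Proof. by rewrite open_cellE => y xy; exists s; rewrite (cell_eq xy). Qed.

Lemma closed_cell (s : nat * seq J) (x : nat) :
  closed (cell s x : set (cell_space C)).
Proof.
rewrite -openC open_cellE => y nxy; exists s => z yz xz; apply: nxy.
by apply: cell_trans xz _; apply: cell_sym.
Qed.

Lemma nbhs_cellP (x : (cell_space C)) (A : set (cell_space C)) :
  nbhs x A <-> exists s, cell s x `<=` A.
Proof.
rewrite nbhsE; split=> [[V [Vo Vx] VA]|[s sA]].
  move: Vo; rewrite open_cellE => /(_ x Vx)[s sV].
  by exists s; apply: subset_trans VA.
by exists (cell s x) => //; split; [exact: open_cell|exact: cell_refl].
Qed.

Lemma cell_countable : countable [set: (cell_space C)].
Proof. exact: (@countableP nat). Qed.

Lemma cell_hausdorff : hausdorff_space (cell_space C).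
Proof.
move=> x y xy; apply: contrapT => /cong_sep[k nxy].
have nb (z : (cell_space C)) : nbhs z (cell (k, [::]) z).
  by apply/nbhs_cellP; exists (k, [::]).
have [z [[xz _] [yz _]]] := xy _ _ (nb x) (nb y).
by apply: nxy; apply: cong_trans xz _; apply: esym.
Qed.

Definition cells : set (set (cell_space C)) :=
  range (fun p : (nat * seq J) * nat => cell p.1 p.2).

Lemma cell_clopen_base : has_clopen_base (cell_space C).
Proof.
exists cells; last first.
  by move=> _ [[s x] _ <-]; split; [apply: open_cell|apply: closed_cell].
split; first by move=> _ [[s x] _ <-]; exact: open_cell.
move=> x A /nbhs_cellP[s sA]; exists (cell s x) => //.
by split; [exists (s, x)|exact: cell_refl].
Qed.

Lemma cell_pi_base : @pi_base (cell_space C) cells.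
Proof.
split=> [_ [[s x] _ <-]|O Oo [x Ox]].
  by split; [exact: open_cell|exists x; exact: cell_refl].
move: Oo; rewrite open_cellE => /(_ x Ox)[s sO]; exists (cell s x) => //.
by exists (s, x).
Qed.

Lemma cell_frechet_urysohn :
  (forall (A : set nat) x, (forall s, exists2 y, A y & cell s x y) -> ~ A x ->
    exists2 u : nat -> nat, (forall i, A (u i)) &
      forall s, \forall i \near \oo, cell s x (u i)) ->
  frechet_urysohn (cell_space C).
Proof.
move=> H A x [clA nAx]; have [s|u Au ux] := H A x _ nAx.
  have /clA[y [Ay xy]] : nbhs x (cell s x) by apply/nbhs_cellP; exists s.
  by exists y.
exists u => // B /nbhs_cellP[s sB].
by apply: filterS (ux s) => i /sB.
Qed.

(** The dense sets are the columns. A finite selection from them lies below some [g], and the open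
    set [C j] then misses the selected points of all columns in the infinite set [P]. *)
Lemma cell_not_H_separable :
  (forall n s x, exists2 y, col y = n & cell s x y) ->
  (forall g : nat -> nat, exists (j : J) (P : set nat),
    [/\ infinite_set P, C j !=set0 &
        forall y, C j y -> P (col y) -> (g (col y) <= y)%N]) ->
  ~ H_separable (cell_space C).
Proof.
move=> colD avoid Hsep.
have [n|F [F_fin FA]] := Hsep (fun n => [set y | col y = n]).
  move=> O [x Ox]; rewrite open_cellE => /(_ x Ox)[s sO].
  by have [y yn /sO Oy] := colD n s x; exists y.
have /choice[g gF] : forall n, exists N, forall y, F n y -> (y < N)%N.
  by move=> n; apply: finite_nat_bounded; exact: (F_fin n).1.
have [j [P [Pinf [x Cx] CP]]] := avoid g.
have Co : open (C j : set (cell_space C)).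
  rewrite open_cellE => y Cy; exists (0%N, [:: j]) => z [_ H].
  exact: (List.Forall_inv H).1.
have [y [Cy [n Pn Fy]]] := FA P Pinf (C j) (ex_intro _ x Cx) Co.
have yn := (F_fin n).2 y Fy.
have := CP y Cy; rewrite yn => /(_ Pn).
by rewrite leqNgt (gF n y Fy).
Qed.

End generated_topology.

Arguments cells {J} C.

(** For [U] in [P], record the code of a point of [U] in each [D n]. Were [P] smaller than b, one
    [g] would dominate all these functions, and the points of [D n] with code below [g n] would be a
    selection witnessing H-separability. *)
Lemma pi_base_bound (X : topologicalType) (P : set (set X)) (b : Type) :
  countable [set: X] -> ~ H_separable X -> is_bounding_number b ->
  @pi_base X P -> [set: b] #<= P.
Proof.
move=> /countable_injP[e /in2TT e_inj] nH [_ b_min] [Pop Psub].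
apply: contrapT => bP; apply: nH => D Ddense.
have /choice[d dP] : forall Un : set X * nat, exists m,
    P Un.1 -> exists y, [/\ Un.1 y, D Un.2 y & e y = m].
  case=> U n /=; have [PU|] := pselect (P U); last by exists 0%N.
  have [Uo U0] := Pop U PU; have [y [Uy Dy]] := Ddense n U U0 Uo.
  by exists (e y) => _; exists y.
have : ~ unbounded_family ((fun U n => d (U, n)) @` P).
  by move=> /b_min h; apply: bP; apply: card_le_trans h (card_image_le _ _).
move=> /contrapT[g gP].
exists (fun n => [set y | D n y /\ (e y < g n)%N]); split=> [n|A Ainf O O0 Oo].
  split; last by move=> y [].
  apply: sub_finite_set (finite_preimage (B := `I_(g n)) (in2W e_inj) _) => //.
  by move=> y [].
have [U PU UO] := Psub O Oo O0.
have /nearP[N HN] := gP _ (ex_intro2 _ _ U PU erefl).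
have [n An Nn] : exists2 n, A n & (N <= n)%N.
  apply: contrapT => H; apply: Ainf; apply: sub_finite_set (finite_II N) => n An.
  by rewrite /= ltnNge; apply/negP => Nn; apply: H; exists n.
have [y [Uy Dy yd]] := dP (U, n) PU.
exists y; split; first exact: UO.
by exists n => //; split=> //; rewrite yd; apply: HN.
Qed.

Definition frechet_urysohn_example : Prop :=
  exists X : topologicalType,
    [/\ countable [set: X], hausdorff_space X, has_clopen_base X,
        frechet_urysohn X &
        ~ H_separable X /\
        exists b : Type, is_bounding_number b /\ is_pi_weight X b].

Lemma cell_space_spec (J b : Type) (C : J -> set nat) : is_bounding_number b ->
  (forall n s x, exists2 y, col y = n & cell C s x y) ->
  (forall (A : set nat) x, (forall s, exists2 y, A y & cell C s x y) -> ~ A x ->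
    exists2 u : nat -> nat, (forall i, A (u i)) &
      forall s, \forall i \near \oo, cell C s x (u i)) ->
  (forall g : nat -> nat, exists (j : J) (P : set nat),
    [/\ infinite_set P, C j !=set0 &
        forall y, C j y -> P (col y) -> (g (col y) <= y)%N]) ->
  cells C #<= [set: b] ->
  frechet_urysohn_example.
Proof.
move=> b_bound colD fu avoid Cb; exists (cell_space C).
have nH := cell_not_H_separable colD avoid.
split.
- exact: cell_countable.
- exact: cell_hausdorff.
- exact: cell_clopen_base.
- exact: cell_frechet_urysohn.
split=> //; exists b; split=> //; split.
  exists (cells C); first exact: cell_pi_base.
  apply: Cantor_Bernstein => //.
  by apply: pi_base_bound b_bound _ => //; [exact: cell_countable|exact: cell_pi_base].
by move=> P; apply: pi_base_bound => //; exact: cell_countable.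
Qed.

(** * Cardinals and domination *)

Lemma card_le_injP (T U : Type) :
  [set: T] #<= [set: U] <-> exists f : T -> U, injective f.
Proof.
split=> [/card_leP[f]|[f f_inj]].
  exists (fun x => val (f (to_setT x))) => x y /val_inj e.
  have : to_setT x = to_setT y by apply: (inj (f := f)); rewrite ?inE.
  by move=> /(congr1 val).
apply: card_le_trans (subset_card_le (subsetT (range f))).
by have /card_eqPle[] := inj_card_eq (A := setT) (in2W f_inj).
Qed.

Lemma card_le_setP (T U : Type) (A : set U) :
  [set: T] #<= A <-> exists2 f : T -> U, injective f & forall x, A (f x).
Proof.
split=> [TA|[f f_inj fA]].
  have /card_le_injP[f f_inj] : [set: T] #<= [set: A].
    by apply: card_le_trans TA _; have /card_eqPle[] := card_setT A.
  exists (fun x => val (f x)) => [x y /val_inj /f_inj //|x].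
  exact: set_valP.
apply: (@card_le_trans _ _ _ (range f)).
  by have /card_eqPle[] := inj_card_eq (A := setT) (in2W f_inj).
by apply: subset_card_le => _ [x _ <-].
Qed.

(* A maximal family of choice functions that pairwise differ everywhere must
   exhaust one of the coordinates, and that coordinate embeds in all others. *)
Lemma least_cardinal (J : Type) (F : J -> Type) (j0 : J) :
  exists j, forall i, [set: F j] #<= [set: F i].
Proof.
pose P (G : set (forall j, F j)) :=
  forall p q, G p -> G q -> (exists j, p j = q j) -> p = q.
have [|G [GP Gmax]] := @Zorn_bigcup (forall j, F j) P.
  move=> X XP Xtot p q [A XA Ap] [B XB Bq].
  by have [AB|BA] := Xtot A B XA XB;
    [apply: (XP B XB) => //; apply: AB|apply: (XP A XA) => //; apply: BA].
have [j jG] : exists j, forall a : F j, exists2 p, G p & p j = a.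
  apply: contrapT => H.
  have /(_ _)/cid-/all_sig[p pP] : forall j, exists a : F j,
      forall q, G q -> q j <> a.
    move=> j; apply: contrapT => Hj; apply: H; exists j => a.
    apply: contrapT => Ha; apply: Hj; exists a => q Gq qa; apply: Ha.
    by exists q.
  apply: (Gmax (G `|` [set p])).
    split; first by move=> q; left.
    by move=> /(_ p (or_intror erefl)) /pP - /(_ j0).
  move=> q r [Gq|->] [Gr|->] // [j e].
  - by apply: GP => //; exists j.
  - by have := pP j q Gq.
  - by have := pP j r Gr; rewrite e.
exists j => i; apply/card_le_injP.
have /choice[p pP] : forall a : F j, exists p, G p /\ p j = a.
  by move=> a; have [p] := jG a; exists p.
exists (fun a => p a i) => a a' e.
rewrite -(pP a).2 -(pP a').2; congr (_ j).
by apply: GP; [exact: (pP a).1|exact: (pP a').1|exists i].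
Qed.

Lemma card_le_total (T U : Type) :
  [set: T] #<= [set: U] \/ [set: U] #<= [set: T].
Proof.
have [[] H] := @least_cardinal bool (fun c => if c then T else U) true.
  by left; exact: (H false).
by right; exact: (H true).
Qed.

Lemma bounding_number_exists : exists b : Type, is_bounding_number b.
Proof.
have unbT : unbounded_family setT.
  by move=> [g /(_ g I)] /nearP[N /(_ N (leqnn N))]; rewrite ltnn.
pose J := {A : set (nat -> nat) | unbounded_family A}.
have [[A unbA] Amin] :=
  @least_cardinal J (fun A => set_type (sval A)) (exist _ setT unbT).
exists (set_type A); split; first by exists A => //; exact: card_setT_sym.
move=> B unbB; apply: card_le_trans (Amin (exist _ B unbB)) _.
by have /card_eqPle[] := card_setT B.
Qed.

Definition well_ordering (K : Type) (R : K -> K -> Prop) : Prop :=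
  [/\ well_founded R, forall x y, [\/ R x y, x = y | R y x] &
      forall x y z, R x y -> R y z -> R x z].

Lemma wf_min (K : Type) (R : K -> K -> Prop) (P : K -> Prop) :
  well_founded R -> (exists x, P x) ->
  exists2 x, P x & forall y, R y x -> ~ P y.
Proof.
move=> Rwf [x Px]; apply: contrapT => H.
elim/(well_founded_ind Rwf): x Px => x IH Px.
by apply: H; exists x => // y /IH.
Qed.

Lemma well_ordering_exists (K : Type) : exists R : K -> K -> Prop, well_ordering R.
Proof.
elim/Peq: K => K.
have [R0 R0wo] := well_ordering_principle K.
have R0min (P : K -> Prop) : (exists x, P x) ->
    exists2 x, P x & forall y, P y -> R0 x y.
  move=> [x Px]; have [|z [[zP zmin] _]] := R0wo [pred x | `[< P x >]].
    by exists x; apply/asboolP.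
  by exists z => [|y Py]; [apply/asboolP|apply: zmin; apply/asboolP].
have R0anti x y : R0 x y -> R0 y x -> x = y.
  move=> xy yx; have R0xx z : R0 z z.
    by have [|w -> ->] := R0min (fun w => w = z); [exists z| |].
  (* Antisymmetry comes from the uniqueness of the minimum of the pair. *)
  have [|z [[zP zmin] zuniq]] := R0wo [pred z | (z == x) || (z == y)].
    by exists x; rewrite inE eqxx.
  have mx : minimum_of R0 [pred z | (z == x) || (z == y)] x.
    by split; [rewrite inE eqxx|move=> w /orP[] /eqP ->].
  have my : minimum_of R0 [pred z | (z == x) || (z == y)] y.
    by split; [rewrite inE eqxx orbT|move=> w /orP[] /eqP ->].
  by rewrite -(zuniq _ mx) (zuniq _ my).
have R0total x y : R0 x y \/ R0 y x.
  have [|z [->|->] zmin] := R0min (fun z => z = x \/ z = y); first by exists x; left.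
    by left; apply: zmin; right.
  by right; apply: zmin; left.
exists (fun x y => R0 x y /\ x <> y); split.
- move=> x; apply: contrapT => nAx.
  have [|z nAz zmin] := R0min (fun z => ~ Acc (fun x y => R0 x y /\ x <> y) z).
    by exists x.
  apply: nAz; constructor => y [yz ynz]; apply: contrapT => /zmin zy.
  by apply: ynz; apply: R0anti.
- move=> x y; have [->|xy] := pselect (x = y); first by constructor 2.
  by have [|] := R0total x y; [constructor 1|constructor 3 => //; split=> // /esym].
- move=> x y z [xy nxy] [yz nyz].
  (* Transitivity: the least of the three elements must be [x]. *)
  have [|w wP wmin] := R0min (fun w => [\/ w = x, w = y | w = z]).
    by exists x; constructor 1.
  have wx := wmin _ (Or31 _ _ erefl); have wy := wmin _ (Or32 _ _ erefl).
  have wz := wmin _ (Or33 _ _ erefl).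
  have xz : R0 x z.
    case: wP => e; subst w => //; first by case: nxy; apply: R0anti.
    by case: nyz; apply: R0anti.
  by split=> // e; subst z; apply: nxy; apply: R0anti.
Qed.

(* The order type of [R] is then an initial ordinal. *)
Lemma initial_well_ordering (K : Type) : exists R : K -> K -> Prop,
  well_ordering R /\ forall x, ~ ([set: K] #<= [set y | R y x]).
Proof.
have [R [Rwf Rtri Rtr]] := well_ordering_exists K.
have [big|small] := pselect (exists x, [set: K] #<= [set y | R y x]); last first.
  by exists R; split=> // x Kx; apply: small; exists x.
(* The order is pulled back along an embedding of [K] into the first segment as large as [K]. *)
have [a /card_le_setP[f f_inj fa] amin] := wf_min Rwf big.
exists (fun x y => R (f x) (f y)); split; first split.
- move=> x; move: {2}(f x) (erefl (f x)) => y.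
  elim/(well_founded_ind Rwf): y x => y IH x fx; constructor => z zx.
  by apply: (IH (f z)) => //; rewrite -fx.
- move=> x y; have [xy|/f_inj ->|yx] := Rtri (f x) (f y).
  + by constructor 1.
  + by constructor 2.
  + by constructor 3.
- by move=> x y z; apply: Rtr.
- move=> x /card_le_setP[g g_inj gx]; apply: (amin (f x)); first exact: fa.
  by apply/card_le_setP; exists (f \o g) => // y z /f_inj /g_inj.
Qed.

Section limit_decomposition.
Variables (K : Type) (R : K -> K -> Prop).
Hypotheses (Rwo : well_ordering R) (Rnomax : forall x, exists y, R x y).

(* Every element is a finite iterate of the successor map at an element that
   is not a successor. *)
Lemma card_prod_nat_le : [set: K * nat] #<= [set: K].
Proof.
have [Rwf Rtri Rtr] := Rwo.
have Rirr x : ~ R x x.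
  move=> xx; have [|y <- ymin] := @wf_min _ _ (eq x) Rwf; first by exists x.
  exact: ymin xx erefl.
have /choice[suc sucP] : forall x, exists y, R x y /\ forall z, R z y -> ~ R x z.
  move=> x; have [y xy ymin] := wf_min Rwf (Rnomax x).
  by exists y; split.
have suc_lt x y : R x y -> R (suc x) (suc y).
  move=> xy; have [//|e|h] := Rtri (suc x) (suc y).
    by have := (sucP x).2 y; rewrite e => /(_ (sucP y).1).
  by have := (sucP x).2 y (Rtr _ _ _ (sucP y).1 h).
have suc_inj : injective suc.
  move=> x y e; have [/suc_lt|//|/suc_lt] := Rtri x y; rewrite e => /Rirr //.
pose lim x := forall y, suc y <> x.
have dec w : exists x : K * nat, lim x.1 /\ iter x.2 suc x.1 = w.
  elim/(well_founded_ind Rwf): w => w IH.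
  have [lw|] := pselect (lim w); first by exists (w, 0%N).
  move=> /existsNP[y /contrapT yw]; have [|[l n] /= [ll ln]] := IH y.
    by rewrite -yw; exact: (sucP y).1.
  by exists (l, n.+1); split=> //=; rewrite ln.
have dec_uniq l l' n n' : lim l -> lim l' ->
    iter n suc l = iter n' suc l' -> l = l' /\ n = n'.
  move=> ll ll'; elim: n n' => [|n IH] [|n'] /=.
  - by [].
  - by move=> e; case: (ll (iter n' suc l')).
  - by move=> e; case: (ll' (iter n suc l)).
  - by move=> /suc_inj /IH[-> ->].
have [d dP] := choice dec.
apply/card_le_injP.
(* The limit part of [x] is kept; its finite part and [i] are coded together as a new finite
   part. *)
exists (fun p : K * nat => iter (pickle ((d p.1).2, p.2)) suc (d p.1).1).
move=> [x i] [y j] /= /dec_uniq[| |dd /(pcan_inj pickleK)[ii ->]].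
- exact: (dP x).1.
- exact: (dP y).1.
- by rewrite -(dP x).2 -(dP y).2 dd ii.
Qed.

End limit_decomposition.

(** Transfinite recursion with choice. As the requirement at [k] reads [h] only below [k], a partial
    history can be padded with [d0]. *)
Lemma wf_dependent_choice (K D : Type) (R : K -> K -> Prop)
    (P : (K -> D) -> K -> D -> Prop) (d0 : D) :
  well_founded R ->
  (forall h h' k d, (forall l, R l k -> h l = h' l) -> P h k d -> P h' k d) ->
  (forall h k, (forall l, R l k -> P h l (h l)) -> exists d, P h k d) ->
  exists h, forall k, P h k (h k).
Proof.
move=> Rwf Pext Pstep.
pose ext k (rec : forall l, R l k -> D) l :=
  if pselect (R l k) is left lk then rec l lk else d0.
have /choice[pick pickP] : forall hk : (K -> D) * K, exists d,
    (exists d', P hk.1 hk.2 d') -> P hk.1 hk.2 d.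
  move=> [h k]; have [[d Pd]|nP] := pselect (exists d, P h k d).
    by exists d.
  by exists d0.
pose next k rec := pick (ext k rec, k).
pose h := Fix Rwf (fun _ => D) next.
have hE k : h k = pick (ext k (fun l _ => h l), k).
  rewrite /h Fix_eq // => x f g fg; congr next.
  by apply: functional_extensionality_dep => y; apply: funext => p; apply: fg.
have extE k l : R l k -> h l = ext k (fun l _ => h l) l.
  by rewrite /ext; case: pselect.
exists h => k; elim/(well_founded_ind Rwf): k => k IH.
have [d Pd] := Pstep h k IH.
apply: (Pext (ext k (fun l _ => h l))) => [l lk|]; first by rewrite -extE.
rewrite hE; apply: (pickP (_, _)).
exists d; apply: Pext Pd; exact: extE.
Qed.

Lemma bounded_nat_family (F : nat -> nat -> nat) :
  exists g, forall i, lt_mod_finite (F i) g.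
Proof.
(* At [n] the sum includes [F i n] as soon as [i <= n]. *)
exists (fun n => (\sum_(i < n.+1) F i n).+1) => i; apply/nearP; exists i => n ni.
rewrite ltnS (bigD1 (Ordinal (ni : (i < n.+1)%N))) //=; exact: leq_addr.
Qed.

Lemma bounded_countable_family (I : Type) (A : set I) (F : I -> nat -> nat) :
  countable A -> exists g, forall i, A i -> lt_mod_finite (F i) g.
Proof.
move=> /pfcard_geP[->|[e]]; first by exists id => i [].
have [g gP] := bounded_nat_family (F \o e).
by exists g => i /(@surj _ _ _ _ e)[n _ <-]; exact: gP.
Qed.

Lemma bounded_small_family (b I : Type) (A : set I) (F : I -> nat -> nat) :
  is_bounding_number b -> ~ ([set: b] #<= A) ->
  exists g, forall i, A i -> lt_mod_finite (F i) g.
Proof.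
move=> [_ bmin] bA; apply: contrapT => H; apply: bA.
apply: card_le_trans (card_image_le F A); apply: bmin => -[g gP]; apply: H.
by exists g => i Ai; apply: gP; exists i.
Qed.

Lemma bounding_number_uncountable (b : Type) :
  is_bounding_number b -> ~ countable [set: b].
Proof.
move=> [[A unbA /card_eqPle[Ab _]] _] bN; apply: unbA.
by apply: (@bounded_countable_family _ A id); apply: card_le_trans bN.
Qed.

Lemma lt_mod_finite_maxl (f g h : nat -> nat) :
  lt_mod_finite f g -> lt_mod_finite f (fun n => maxn (g n) (h n)).
Proof. by apply: filterS => n fg; rewrite leq_max fg. Qed.

Lemma lt_mod_finite_maxr (f g h : nat -> nat) :
  lt_mod_finite f h -> lt_mod_finite f (fun n => maxn (g n) (h n)).
Proof. by apply: filterS => n fg; rewrite leq_max fg orbT. Qed.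

Lemma card_nat_functions_le :
  [set: set nat * nat * (nat -> nat)] #<= [set: nat -> bool].
Proof.
apply/card_le_injP.
(* Tag 0 codes the set, tag 1 the number, and the other tags the graph of the function. *)
exists (fun (p : set nat * nat * (nat -> nat)) n =>
  if @unpickle (nat * nat * nat)%type n is Some (i, k, m) then
    if i == 0%N then `[< p.1.1 k >] else
    if i == 1%N then p.1.2 == k else p.2 k == m
  else false).
move=> [[A x] g] [[B y] h] /= e.
have {}e (i k m : nat) := congr1 (fun f => f (pickle (i, k, m))) e.
congr (_, _, _).
- apply/funext => k; apply/propext.
  by have := e 0%N k 0%N; rewrite !pickleK /=; exact: asbool_eq_equiv.
- have := e 1%N x 0%N; rewrite !pickleK /= eqxx => xy.
  by apply/esym/eqP; rewrite -xy.
- apply/funext => k; have := e 2%N k (g k); rewrite !pickleK /= eqxx => gh.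
  by apply/esym/eqP; rewrite -gh.
Qed.

Lemma inj_surj (T U : Type) (t : T) (f : T -> U) : injective f ->
  exists g : U -> T, forall x, exists u, g u = x.
Proof.
move=> f_inj; have /choice[g gP] : forall u, exists y, forall x, f x = u -> y = x.
  move=> u; have [[x <-]|H] := pselect (exists x, f x = u).
    by exists x => y /f_inj.
  by exists t => x fx; case: H; exists x.
by exists g => x; exists (f x); apply: gP.
Qed.

(** * Towers *)

(** Choose [a i] recursively in the first [i.+1] sets, above both the previous term and its image
    under [phi]. *)
Lemma pseudo_intersection (H : nat -> set nat) (phi : nat -> nat) :
  (forall i N, exists n, (N <= n)%N /\ forall j, (j <= i)%N -> H j n) ->
  exists D : set nat, [/\ forall N, exists2 n, (N <= n)%N & D n,
    forall j, \forall n \near \oo, D n -> H j n &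
    forall n m, D n -> D m -> (n < m)%N -> (phi n < m)%N].
Proof.
move=> HH; have /choice[nx nxP] : forall p : nat * nat, exists n,
    (p.2 <= n)%N /\ forall j, (j <= p.1)%N -> H j n.
  by move=> [i N]; apply: HH.
pose a := fix a i := if i is j.+1 then nx (i, (maxn (a j) (phi (a j))).+1)
                     else nx (0, 0)%N.
have aS i : (maxn (a i) (phi (a i)) < a i.+1)%N.
  exact: (nxP (i.+1, (maxn (a i) (phi (a i))).+1)).1.
have aH i j : (j <= i)%N -> H j (a i).
  case: i => [|i]; first exact: (nxP (0, 0)%N).2.
  exact: (nxP (i.+1, (maxn (a i) (phi (a i))).+1)).2.
have a_lt : {homo a : i j / (i < j)%N}.
  by apply: homo_ltn => [i j k|i]; [exact: ltn_trans|
     apply: leq_ltn_trans (leq_maxl _ _) (aS i)].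
have a_le : {homo a : i j / (i <= j)%N}.
  by move=> i j; rewrite leq_eqVlt => /orP[/eqP -> //|/a_lt /ltnW].
have a_ge i : (i <= a i)%N by elim: i => // i IH; apply: leq_ltn_trans IH (a_lt _ _ _).
exists (range a); split.
- by move=> N; exists (a N) => //; exists N.
- move=> j; apply/nearP; exists (a j) => _ /[swap] -[i _ <-] ji; apply: aH.
  by rewrite leqNgt; apply/negP => /a_lt; rewrite ltnNge ji.
- move=> _ _ [i _ <-] [j _ <-] ij.
  have {}ij : (i < j)%N by rewrite ltnNge; apply/negP => /a_le; rewrite leqNgt ij.
  by apply: leq_trans (a_le _ _ ij); apply: leq_ltn_trans (leq_maxr _ _) (aS i).
Qed.

Lemma largest_below (A : set nat) (a m : nat) : A a -> (a <= m)%N ->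
  exists n, [/\ A n, (a <= n <= m)%N & forall k, A k -> (n < k)%N -> (m < k)%N].
Proof.
move=> Aa am; have [||n /andP[/asboolP An nm] nmax] :=
  @ex_maxnP (fun n => `[< A n >] && (n <= m)%N) m.
- by exists a; rewrite am andbT; apply/asboolP.
- by move=> n /andP[].
- exists n; split=> // [|k Ak nk].
    by rewrite nm andbT; apply: nmax; rewrite am andbT; apply/asboolP.
  rewrite ltnNge; apply/negP => km.
  have := nmax k; rewrite km andbT => /(_ (introT (asboolP _) Ak)).
  by rewrite leqNgt nk.
Qed.

Lemma sum_mono (g : nat -> nat) (n m : nat) : (n <= m)%N ->
  (\sum_(i < n.+1) g i <= \sum_(i < m.+1) g i)%N.
Proof.
by move=> nm; rewrite -(subnKC nm) -addSn big_split_ord leq_addr.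
Qed.

Lemma sum_ge (g : nat -> nat) (n : nat) : (g n <= \sum_(i < n.+1) g i)%N.
Proof. by rewrite big_ord_recr leq_addl. Qed.

Section countable_segments.
Variables (K : Type) (R : K -> K -> Prop) (k0 : K).
Hypotheses (Rwo : well_ordering R).
Hypothesis segC : forall k, countable [set l | R l k].
Hypothesis K_unc : ~ countable [set: K].

Lemma segment_enum (k : K) : exists e : nat -> K, forall l, R l k -> exists j, e j = l.
Proof.
have /pfcard_geP[seg0|[e]] := segC k.
  exists (fun _ => k0) => l lk.
  by have : [set l | R l k] l by []; rewrite seg0.
by exists e => l /(@surj _ _ _ _ e)[j _ <-]; exists j.
Qed.

Lemma countable_bounded (s : nat -> K) : exists k, forall i, ~ R k (s i).
Proof.
apply: contrapT => H; apply: K_unc.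
apply: (@sub_countable _ _ _ (\bigcup_i [set l | R l (s i)])); last first.
  by apply: bigcup_countable => [|i _]; [exact: countableP|exact: segC].
apply: subset_card_le => k _; apply: contrapT => nk; apply: H; exists k => i ks.
by apply: nk; exists i.
Qed.

Lemma unbounded_order (x : K) : exists y, R x y.
Proof.
have [_ Rtri _] := Rwo.
apply: contrapT => H; apply: K_unc.
pose F n := if n == 0%N then [set l | R l x] else [set x].
apply: (@sub_countable _ _ _ (\bigcup_n F n)); last first.
  apply: bigcup_countable => [|n _]; first exact: countableP.
  by rewrite /F; case: ifP => _; [exact: segC|exact: countable1].
apply: subset_card_le => z _; have [zx|->|xz] := Rtri z x.
- by exists 0%N.
- by exists 1%N.
- by case: H; exists z.
Qed.

(** A finite list lies below some [k], where the countable segment codes its entries by numbers; so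
    [k] and one number determine the list. *)
Lemma card_cells_le :
  [set: (nat * seq K) * nat] #<= [set: K].
Proof.
have [Rwf Rtri Rtr] := Rwo.
apply: card_le_trans (card_prod_nat_le Rwo unbounded_order).
have /choice[ub ubP] : forall l : seq K, exists k, forall y, List.In y l -> R y k.
  elim=> [|y l [k kP]]; first by exists k0.
  have [z yz] := unbounded_order y.
  have [kz|kz|zk] := Rtri k z.
  - by exists z => w [<- //|/kP wk]; apply: Rtr wk kz.
  - by exists k => w [<-|/kP //]; rewrite kz.
  - by exists k => w [<-|/kP //]; apply: Rtr yz zk.
have /choice[e eP] : forall k, exists e : K -> nat,
    forall x y, R x k -> R y k -> e x = e y -> x = y.
  move=> k; have /countable_injP[e e_inj] := segC k.
  by exists e => x y xk yk; apply: e_inj; rewrite inE.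
apply/card_le_injP.
exists (fun p : (nat * seq K) * nat =>
  (ub p.1.2, pickle (p.1.1, map (e (ub p.1.2)) p.1.2, p.2))).
move=> [[n l] x] [[n' l'] x'] /= [ubE /(pcan_inj pickleK)[-> mapE ->]].
congr (_, _, _); rewrite -ubE in mapE.
have lP := ubP l; have l'P := ubP l'; rewrite -ubE in l'P.
move: (ub l) lP l'P mapE => k {ubE}.
elim: l l' => [|y l IH] [|y' l'] //= lP l'P [ey el].
have -> : y = y' by apply: eP ey; [apply: lP; left|apply: l'P; left].
by rewrite (IH l') // => w wl; [apply: lP; right|apply: l'P; right].
Qed.

(** At [k] only countably many sets have been built, so they have a pseudo-intersection, which can
    be chosen with gaps outgrowing [phi k]. *)
Lemma tower (phi : K -> nat -> nat) : exists A : K -> set nat, forall k,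
  [/\ forall N, exists2 n, (N <= n)%N & A k n,
    forall l, R l k -> \forall n \near \oo, A k n -> A l n &
    forall n m, A k n -> A k m -> (n < m)%N -> (phi k n < m)%N].
Proof.
have [Rwf Rtri Rtr] := Rwo.
apply: (wf_dependent_choice (P := fun h k D =>
  [/\ forall N, exists2 n, (N <= n)%N & D n,
    forall l, R l k -> \forall n \near \oo, D n -> h l n &
    forall n m, D n -> D m -> (n < m)%N -> (phi k n < m)%N]) set0 Rwf).
  by move=> h h' k D hh' [? Dh ?]; split=> // l lk; rewrite -hh' //; apply: Dh.
move=> h k IH; have [e eP] := segment_enum k.
pose H j := [set n | R (e j) k -> h (e j) n].
have [|D [D_unb DH D_gap]] := @pseudo_intersection H (phi k); last first.
  exists D; split=> // l lk; have [j ej] := eP l lk.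
  by apply: filterS (DH j) => n Hn /Hn; rewrite /H /= ej; exact.
(* Among finitely many earlier sets, the one of largest index is almost contained in all the
   others. *)
have below i : (forall j, (j <= i)%N -> ~ R (e j) k) \/
    exists2 l, R l k & \forall n \near \oo, h l n -> forall j, (j <= i)%N -> H j n.
  have none_H j : ~ R (e j) k -> forall n, H j n by move=> nj n /nj.
  elim: i => [|i IHi]; [have [ek|nek] := pselect (R (e 0%N) k)
    | have [ek|nek] := pselect (R (e i.+1) k); case: IHi => [none|[l lk lH]]].
  - right; exists (e 0%N) => //; near=> n => hn j; rewrite leqn0 => /eqP -> _.
    exact: hn.
  - by left => j; rewrite leqn0 => /eqP ->.
  - right; exists (e i.+1) => //; near=> n => hn j; rewrite leq_eqVlt.
    by move=> /orP[/eqP -> _ //|/none/none_H]; exact.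
  - have [le|le|el] := Rtri l (e i.+1).
    + have [_ /(_ l le) el _] := IH _ ek; right; exists (e i.+1) => //.
      apply: filterS2 lH el => n lH el hn j.
      by rewrite leq_eqVlt => /orP[/eqP -> _ //|/(lH (el hn))].
    + right; exists l => //; apply: filterS lH => n lH hn j.
      by rewrite leq_eqVlt => /orP[/eqP -> _|/(lH hn)//]; rewrite -le.
    + have [_ /(_ _ el) le _] := IH _ lk; right; exists l => //.
      apply: filterS2 lH le => n lH le hn j.
      by rewrite leq_eqVlt => /orP[/eqP -> _|/(lH hn)//]; exact: le.
  - by left => j; rewrite leq_eqVlt => /orP[/eqP ->|/none].
  - right; exists l => //; apply: filterS lH => n lH hn j.
    by rewrite leq_eqVlt => /orP[/eqP ->|/(lH hn)//]; exact: none_H.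
move=> i N; have [none|[l lk /nearP[M HM]]] := below i.
  by exists N; split=> // j ji /(none j ji).
have [l_unb _ _] := IH l lk.
have [n] := l_unb (maxn M N); rewrite geq_max => /andP[Mn Nn] hn.
by exists n; split=> //; apply: HM.
Unshelve. all: by end_near. Qed.

End countable_segments.

(** If in every [A k] almost every [n] were followed by an element at most [g n], two such jumps
    would bound [phi k] by [G \o G], for all [k] at once. *)
Lemma tower_gap (b : Type) (phi : b -> nat -> nat) (A : b -> set nat) :
  (~ exists g, forall k, lt_mod_finite (phi k) g) ->
  (forall k n m, (n <= m)%N -> (phi k n <= phi k m)%N) ->
  (forall k N, exists2 n, (N <= n)%N & A k n) ->
  (forall k n m, A k n -> A k m -> (n < m)%N -> (phi k n < m)%N) ->
  forall g : nat -> nat, exists k, forall N, exists n,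
    [/\ (N <= n)%N, A k n & forall m, A k m -> (n < m)%N -> (g n < m)%N].
Proof.
move=> phi_unb phi_mono A_unb A_phi g; apply: contrapT => H; apply: phi_unb.
pose G n := (\sum_(i < n.+1) g i)%N.
exists (fun n => G (G n)) => k.
have [N NP] : exists N, forall n, (N <= n)%N -> A k n ->
    exists2 m, A k m & (n < m <= g n)%N.
  apply: contrapT => Hk; apply: H; exists k => N; apply: contrapT => HN.
  apply: Hk; exists N => n Nn An; apply: contrapT => Hn; apply: HN; exists n.
  split=> // m Am nm; rewrite ltnNge; apply/negP => mg.
  by apply: Hn; exists m => //; rewrite nm.
have [a Na Aa] := A_unb k N; apply/nearP; exists a => m am.
(* With [n <= m < n1 < n2] in [A k], one gets [phi k m <= phi k n1 < n2 <= G n1 <= G (G m)]. *)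
have [n [An /andP[an nm] nmax]] := largest_below Aa am.
have [n1 An1 /andP[nn1 n1g]] := NP n (leq_trans Na an) An.
have [n2 An2 /andP[n12 n2g]] :=
  NP n1 (leq_trans Na (leq_trans an (ltnW nn1))) An1.
have mn1 := nmax _ An1 nn1.
apply: leq_ltn_trans (phi_mono k _ _ (ltnW mn1)) _.
apply: leq_trans (A_phi k _ _ An1 An2 n12) _.
apply: leq_trans n2g _; apply: leq_trans (sum_ge g n1) _.
apply: sum_mono; apply: leq_trans n1g _; apply: leq_trans (sum_ge g n) _.
exact: sum_mono.
Qed.

(** * The case b = omega_1 *)

Section tower_space.
Variables (K : Type) (R : K -> K -> Prop) (k0 : K).
Hypothesis Rwo : well_ordering R.
Hypothesis segC : forall k, countable [set l | R l k].
Hypothesis K_unc : ~ countable [set: K].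
Variables (A : K -> set nat) (next : K -> nat -> nat).
Hypothesis A_dec : forall k l, R l k -> \forall n \near \oo, A k n -> A l n.
Hypothesis A_gap : forall g : nat -> nat, exists k, forall N, exists n,
  [/\ (N <= n)%N, A k n & forall m, A k m -> (n < m)%N -> (g n < m)%N].
Hypothesis nextA : forall k n, A k (next k n).
Hypothesis next_gt : forall k n, (n < next k n)%N.

(** Quantifying over all later elements makes the condition weaken as [A k] shrinks, as happens up
    the tower. *)
Definition before_next (k : K) (n z : nat) : Prop :=
  forall a, A k a -> (n < a)%N -> (z < a)%N.

(** When the gap of [A k] after [n] exceeds [g n], this contains every point of column [n] below
    [g n]; a clopen set disjoint from it is an avoider for [g]. *)
Definition forbidden (k : K) : set nat :=
  [set z | A k (col z) /\ before_next k (col z) z].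

(* Only the clopen sets of index at least [k] will respect [trap k m x]; a
   sequence inside it still has to converge along the earlier ones. *)
Definition trap (k : K) (m x : nat) : set nat :=
  [set z | (exists2 i, cong i x z & before_next k i z) /\
           (A k (col z) -> (col z <= m)%N)].

Lemma before_next_lt (k : K) (n z : nat) : before_next k n z -> (z < next k n)%N.
Proof. by apply. Qed.

Lemma trap_funnel (k : K) (m x : nat) : trap k m x `<=` funnel (next k) x.
Proof. by move=> z [[i xz zi] _]; exists i => //; exact: before_next_lt. Qed.

(** Beyond some [N] all elements of [A k] are in [A l]. Large points use a precision [i] beyond [N],
    and the condition on [col z] excludes the columns between [m] and [N]. *)
Lemma trap_mono (l k : K) (m x : nat) : R l k -> exists M, forall z,
  trap l m x z -> (M <= z)%N -> (col z <= m)%N \/ (M <= col z)%N -> trap k m x z.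
Proof.
move=> lk; have /nearP[N HN] := A_dec lk.
exists (maxn N (next l N)) => z [[i xz zi] zm]; rewrite geq_max => /andP[Nz lz] cz.
have Ni : (N <= i)%N.
  rewrite leqNgt; apply/negP => iN.
  have : (z < next l N)%N by apply: zi (nextA _ _) (ltn_trans iN (next_gt _ _)).
  by rewrite ltnNge lz.
split; first by exists i => // a Aa ia; apply: (zi a _ ia); apply: HN => //;
  exact: leq_trans Ni (ltnW ia).
move=> Az; case: cz => //; rewrite geq_max => /andP[Nc _].
by apply: zm; apply: HN.
Qed.

(** A forbidden point of the trap has its column in [A k], hence bounded by [maxn N m]; lying before
    the next element of [A k], it is bounded too. *)
Lemma trap_allowed (l k : K) (m x : nat) : R l k \/ l = k ->
  \forall z \near \oo, trap l m x z -> ~ forbidden k z.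
Proof.
move=> lk; have /nearP[N HN] : \forall n \near \oo, A k n -> A l n.
  by case: lk => [/A_dec //|->]; near=> n.
apply/nearP; exists (next k (maxn N m)) => z zN [_ zm] [Az zb].
have cz : (col z <= maxn N m)%N.
  rewrite leq_max; have [Nc|] := leqP N (col z); last by move=> /ltnW ->.
  by rewrite (zm (HN _ Nc Az)) orbT.
have := zb _ (nextA k (maxn N m)) (leq_ltn_trans cz (next_gt _ _)).
by rewrite ltnNge zN.
Unshelve. all: by end_near. Qed.

Section clopen_sets.
Variable q : nat -> nat -> nat -> nat.
Hypothesis qP : forall n x i,
  [/\ (i <= q n x i)%N, cong i x (q n x i) & col (q n x i) = n].

(** Only countably many promises are to be respected, so one [f] controls their funnels and
    [separation] applies with [forbidden k] as the set to avoid. *)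
Lemma tower_clopen (k : K) : exists U : set nat, [/\ U !=set0,
  forall z, forbidden k z -> ~ U z,
  forall n x, \forall z \near \oo, range (q n x) z -> (U z <-> U x) &
  forall l m x, R l k \/ l = k ->
    \forall z \near \oo, trap l m x z -> (U z <-> U x)].
Proof.
have [f1 f1P] := bounded_countable_family next (segC k).
have [f2 f2P] := bounded_countable_family (A := [set: nat * nat])
  (fun p i => (q p.1 p.2 i).+1) (countableP _).
pose f n := maxn (maxn (f1 n) (f2 n)) (next k n).+1.
have ff1 l : R l k -> lt_mod_finite (next l) f.
  by move=> lk; do 2 apply: lt_mod_finite_maxl; exact: f1P.
have ff2 p : lt_mod_finite (fun i => (q p.1 p.2 i).+1) f.
  by apply: lt_mod_finite_maxl; apply: lt_mod_finite_maxr; exact: f2P.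
have ff3 : lt_mod_finite (next k) f by apply: lt_mod_finite_maxr; near=> n.
have [x0 [x0_ge _ x0_col]] := col_dense 0 0 (next k 0).
have [|U [Ux0 UE Uf]] := @separation f (forbidden k) x0.
  by move=> [_]; rewrite x0_col => /before_next_lt; rewrite ltnNge x0_ge.
exists U; split=> //; first by exists x0.
- move=> n x; apply: Uf => [|_].
    apply: filterS (funnel_mod x (ff2 (n, x))) => z fz [i _ qz]; apply: fz.
    by exists i; rewrite -qz //; have [] := qP n x i.
  apply/nearP; exists (next k n) => z zn [i _ zi] [Az /before_next_lt].
  have -> : col z = n by rewrite -zi; have [] := qP n x i.
  by rewrite ltnNge zn.
- move=> l m x lk; apply: Uf => [|_]; last exact: trap_allowed.
  have lf : lt_mod_finite (next l) f by case: lk => [/ff1 //|->].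
  by apply: filterS (funnel_mod x lf) => z fz /trap_funnel.
Unshelve. all: by end_near. Qed.

Variable U : K -> set nat.
Hypothesis U0 : forall k, U k !=set0.
Hypothesis U_forbidden : forall k z, forbidden k z -> ~ U k z.
Hypothesis Uq : forall k n x,
  \forall z \near \oo, range (q n x) z -> (U k z <-> U k x).
Hypothesis Utrap : forall k l m x, R l k \/ l = k ->
  \forall z \near \oo, trap l m x z -> (U k z <-> U k x).

Lemma tower_col_dense (n : nat) (s : nat * seq K) (x : nat) :
  exists2 y, col y = n & cell U s x y.
Proof.
have /nearP[N HN] : \forall i \near \oo, cell U s x (q n x i).
  apply: near_cell => [i|k]; first by have [] := qP n x i.
  have /nearP[N HN] := Uq k n x; apply/nearP; exists N => i Ni.
  by apply: HN; [have [iq _ _] := qP n x i; exact: leq_trans iq|exists i].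
by exists (q n x N); [have [] := qP n x N|exact: HN].
Qed.

Lemma tower_avoid (g : nat -> nat) : exists (k : K) (P : set nat),
  [/\ infinite_set P, U k !=set0 &
      forall y, U k y -> P (col y) -> (g (col y) <= y)%N].
Proof.
have [k kP] := A_gap g.
exists k, [set n | A k n /\ forall m, A k m -> (n < m)%N -> (g n < m)%N]; split=> //.
  by apply: unbounded_infinite => N; have [n [Nn An ng]] := kP N; exists n.
move=> y Uy [Ay yg]; rewrite leqNgt; apply/negP => yg'.
apply: (U_forbidden _ Uy); split=> // a Aa ya.
exact: ltn_trans yg' (yg a Aa ya).
Qed.

Section frechet.
Variables (B : set nat) (x : nat).
Hypothesis Bx : ~ B x.
Hypothesis clB : forall s, exists2 y, B y & cell U s x y.

(** The columns of a sequence of such points are bounded by [m] or escape to infinity, which is what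
    moving up by [trap_mono] requires. *)
Let good (m i y : nat) : Prop :=
  [/\ B y, cong i x y, (i <= y)%N & (col y <= m)%N \/ (i <= col y)%N].

(** Suppose 0 fails at precision [i], and then [i] itself fails as a column bound. A point of [B]
    near [x] has its column either at most [i] or above it, and contradicts one of the two
    failures. *)
Lemma good_approx : exists m, forall s i, exists2 y, good m i y & cell U s x y.
Proof.
apply: contrapT => H.
have bad m : exists s i, forall y, good m i y -> ~ cell U s x y.
  apply: contrapT => Hm; apply: H; exists m => s i; apply: contrapT => Hsi.
  by apply: Hm; exists s, i => y gy sy; apply: Hsi; exists y.
have [s [i si]] := bad 0%N; have [t [j tj]] := bad i.
pose st := (maxn s.1 t.1, s.2 ++ t.2).
(* The precision [x + maxn i j] forces [y], being different from [x], to be at least [maxn i j]. *)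
have [y By sty] := clB (maxn st.1 (x + maxn i j), st.2 ++ [::]).
have sy := cell_capl (cell_capl (t := (x + maxn i j, [::])) sty).
have ty := cell_capr (cell_capl (t := (x + maxn i j, [::])) sty).
have xy : cong (x + maxn i j) x y by case: sty => /cong_le + _; apply; rewrite leq_maxr.
have ij_y : (maxn i j <= y)%N by apply: (cong_large xy) => xy'; apply: Bx; rewrite xy'.
have iy : (i <= y)%N by apply: leq_trans ij_y; rewrite leq_maxl.
have jy : (j <= y)%N by apply: leq_trans ij_y; rewrite leq_maxr.
have ciy : cong i x y.
  by apply: cong_le xy; apply: leq_trans (leq_maxl _ _) (leq_addl _ _).
have cjy : cong j x y.
  by apply: cong_le xy; apply: leq_trans (leq_maxr i _) (leq_addl _ _).
have [yi|iy'] := leqP (col y) i.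
  by apply: (tj y _ ty); split=> //; left.
by apply: (si y _ sy); split=> //; right; apply: ltnW.
Qed.

Variable m : nat.
Hypothesis mP : forall s i, exists2 y, good m i y & cell U s x y.

Lemma partial_sequence (k : K) : exists u : nat -> nat,
  (forall i, good m i (u i)) /\
  forall l, R l k -> \forall i \near \oo, U l (u i) <-> U l x.
Proof.
have [e eP] := segment_enum k0 segC k.
have /choice[u uP] : forall i, exists y, good m i y /\
    cell U (0%N, [seq e j | j <- iota 0 i.+1]) x y.
  by move=> i; have [y] := mP (0%N, [seq e j | j <- iota 0 i.+1]) i; exists y.
exists u; split=> [i|l lk]; first exact: (uP i).1.
have [j <-] := eP l lk; apply/nearP; exists j => i ji.
have [_ [_ /List.Forall_forall H]] := uP i; apply: iff_sym; apply: H.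
have : j \in iota 0 i.+1 by rewrite mem_iota add0n ltnS.
elim: (iota 0 i.+1) => //= a s IH; rewrite inE => /orP[/eqP ->|/IH]; by [left|right].
Qed.

(** Where the gap of [A k] after [n] exceeds both [u n.+1] and its column, that point lies before
    the next element, and its column, if beyond [n], falls inside the gap. *)
Lemma trapped (u : nat -> nat) : (forall i, good m i (u i)) ->
  exists k, forall N, exists2 i, (N <= i)%N & trap k m x (u i).
Proof.
move=> uP.
have [k kP] := A_gap (fun n => maxn (u n.+1) (col (u n.+1))).
exists k => N; have [n [Nn An nP]] := kP N; exists n.+1; first exact: leqW.
have [_ xu nu cu] := uP n.+1; split.
  exists n; first exact: cong_le xu.
  by move=> a Aa na; apply: leq_ltn_trans (nP a Aa na); rewrite leq_maxl.
move=> Ac; case: cu => // nc.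
by have := nP _ Ac nc; rewrite ltnNge leq_maxr.
Qed.

Lemma trapped_above (k : K) (u : nat -> nat) : (forall i, good m i (u i)) ->
  exists k', (k = k' \/ R k k') /\
    forall N, exists2 i, (N <= i)%N & trap k' m x (u i).
Proof.
move=> uP; have [l lP] := trapped uP.
have [_ Rtri _] := Rwo.
have [kl|kl|lk] := Rtri k l; first by exists l; split=> //; right.
  by exists l; split=> //; left.
exists k; split; first by left.
move=> N; have [M HM] := trap_mono m x lk.
have [i] := lP (maxn N M); rewrite geq_max => /andP[Ni Mi] ui.
exists i => //; have [_ _ iu cu] := uP i.
apply: HM => //; first exact: leq_trans iu.
by case: cu => [|iu']; [left|right; exact: leq_trans iu'].
Qed.

(** Along increasing indices [a i], take sequences converging for all clopen sets below [a i] and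
    often trapped at [a i.+1]. A diagonal sequence is trapped at the supremum [d], which handles all
    indices from [d] on. *)
Lemma tower_frechet : exists2 u : nat -> nat, (forall i, B (u i)) &
  forall s, \forall i \near \oo, cell U s x (u i).
Proof.
have [Rwf Rtri Rtr] := Rwo.
have /choice[F FP] : forall k, exists k', (k = k' \/ R k k') /\
    exists u : nat -> nat, [/\ forall i, good m i (u i),
      forall l, R l k -> \forall i \near \oo, U l (u i) <-> U l x &
      forall N, exists2 i, (N <= i)%N & trap k' m x (u i)].
  move=> k; have [u [uP uk]] := partial_sequence k.
  by have [k' [kk' uk']] := trapped_above k uP; exists k'; split=> //; exists u.
pose a i := iter i F k0.
have a_mono l i j : R l (a i) -> (i <= j)%N -> R l (a j).
  move=> li; elim: j => [|j IH]; first by rewrite leqn0 => /eqP <-.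
  rewrite leq_eqVlt => /orP[/eqP <- //|/IH lj].
  have [[ajS|ajS] _] := FP (a j); last exact: Rtr lj ajS.
  by rewrite /a iterS -/(a j) -ajS.
(* [d] is the supremum of the [a i]; it exists because [K] has uncountable cofinality. *)
have [d ad dmin] := wf_min Rwf (countable_bounded segC K_unc a).
have below_d l : R l d -> exists i, R l (a i).
  by move=> /dmin nl; apply: contrapT => H; apply: nl => i li; apply: H; exists i.
have [e eP] := segment_enum k0 segC d.
have /choice[u uP] : forall i, exists y, [/\ good m i y, trap d m x y &
    forall j, (j <= i)%N -> R (e j) (a i) -> (U (e j) y <-> U (e j) x)].
  move=> i; have [_ [v [vP vU v_trap]]] := FP (a i).
  have /nearP[N1 N1P] : \forall t \near \oo, forall j, (j < i.+1)%N ->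
      R (e j) (a i) -> (U (e j) (v t) <-> U (e j) x).
    apply: near_forall_lt => j _; have [/vU|nj] := pselect (R (e j) (a i)).
      by apply: filterS => t + _.
    by near=> t.
  have [N2 N2P] : exists M, forall z, trap (F (a i)) m x z -> (M <= z)%N ->
      (col z <= m)%N \/ (M <= col z)%N -> trap d m x z.
    have [|->|dF] := Rtri (F (a i)) d; first exact: trap_mono.
      by exists 0%N.
    by case: (ad i.+1).
  have [t] := v_trap (maxn i (maxn N1 N2)).
  rewrite !geq_max => /and3P[it N1t N2t] vt.
  have [Bv xv tv cv] := vP t; exists (v t); split.
  - split=> //; [exact: cong_le xv|exact: leq_trans tv|].
    by case: cv => [|tc]; [left|right; exact: leq_trans tc].
  - apply: N2P => //; first exact: leq_trans tv.
    by case: cv => [|tc]; [left|right; exact: leq_trans tc].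
  - by move=> j ji; apply: N1P.
exists u => [i|]; first by have [[]] := uP i.
apply: near_cell => [i|l]; first by have [[]] := uP i.
have [/[dup] ld /below_d[i0 li0]|dl] := pselect (R l d).
  have [j ej] := eP l ld; apply/nearP; exists (maxn i0 j) => i.
  rewrite geq_max => /andP[i0i ji]; have [_ _ /(_ j ji)] := uP i.
  by rewrite ej; apply; exact: a_mono i0i.
have {}dl : R d l \/ d = l by have [//|->|] := Rtri l d; [right|left].
have /nearP[N HN] := Utrap m x dl; apply/nearP; exists N => i Ni.
by have [[_ _ iu _] ui _] := uP i; apply: HN => //; exact: leq_trans iu.
Unshelve. all: by end_near. Qed.

End frechet.
End clopen_sets.
End tower_space.

Lemma countable_segments_space (b : Type) (R : b -> b -> Prop) :
  is_bounding_number b -> well_ordering R -> (forall k, countable [set l | R l k]) ->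
  frechet_urysohn_example.
Proof.
move=> b_bound Rwo segC; have b_unc := bounding_number_uncountable b_bound.
have [[Fam Fam_unb /card_eqPle[Fam_b _]] _] := b_bound.
have Fam0 : Fam !=set0.
  apply: contrapT => F0; apply: Fam_unb; exists id => f Ff.
  by case: F0; exists f.
have [phi0 phi0P] : exists phi : b -> nat -> nat, forall f, Fam f -> exists k, phi k = f.
  case/pfcard_geP: Fam_b => [F0|[phi]]; first by case: Fam0 => f; rewrite F0.
  by exists phi => f /(@surj _ _ _ _ phi)[k _ <-]; exists k.
have [k0 _] : exists k : b, True by have [f /phi0P[k _]] := Fam0; exists k.
(* Partial sums make the functions monotone and keep the family unbounded. *)
pose phi k n := (\sum_(i < n.+1) phi0 k i)%N.
have [A AP] := tower k0 Rwo segC phi.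
have A_unb k : forall N, exists2 n, (N <= n)%N & A k n by have [] := AP k.
have /choice[next nextP] : forall p : b * nat, exists n, (p.2 < n)%N /\ A p.1 n.
  by move=> [k N]; have [n Nn An] := A_unb k N.+1; exists n.
have A_gap : forall g : nat -> nat, exists k, forall N, exists n,
    [/\ (N <= n)%N, A k n & forall m, A k m -> (n < m)%N -> (g n < m)%N].
  apply: (@tower_gap b phi) => // [[g gP]|k n m|k].
  - apply: Fam_unb; exists g => f /phi0P[k <-].
    by apply: filterS (gP k) => n; apply: leq_ltn_trans; exact: sum_ge.
  - exact: sum_mono.
  - by have [] := AP k.
have A_dec k l : R l k -> \forall n \near \oo, A k n -> A l n.
  by have [_ + _] := AP k; apply.
have nextA k n : A k (next (k, n)) := (nextP (k, n)).2.
have next_gt k n : (n < next (k, n))%N := (nextP (k, n)).1.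
have [q qP] := col_sequence.
have /choice[U UP] := tower_clopen segC A_dec nextA next_gt qP.
apply: (@cell_space_spec b b U) => //.
- by apply: (tower_col_dense qP) => k n x; have [] := UP k.
- move=> B x clB Bx; have [m mP] := good_approx Bx clB.
  apply: (tower_frechet k0 Rwo segC b_unc A_dec A_gap nextA next_gt _ mP).
  by move=> k l m' x' lk; have [_ _ _] := UP k; apply.
- by apply: (tower_avoid A_gap) => k; have [] := UP k.
- apply: card_le_trans (card_image_le _ _) _.
  exact: card_cells_le k0 Rwo segC b_unc.
Qed.

(** * The case b = c *)

(** The codes of the finite initial segments of [r]: the usual almost disjoint family of size c. *)
Definition branch (r : nat -> bool) : set nat :=
  range (fun k => pickle (mkseq r k)).

Lemma branch_unbounded (r : nat -> bool) (N : nat) :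
  exists2 n, (N <= n)%N & branch r n.
Proof.
have inj : injective (fun k => pickle (mkseq r k)).
  by move=> i j /(pcan_inj pickleK) /(congr1 size); rewrite !size_mkseq.
by have [k /ltnW] := injective_gtn inj N; eexists; first eassumption; exists k.
Qed.

Lemma branch_disjoint (r s : nat -> bool) : r <> s ->
  \forall n \near \oo, branch r n -> ~ branch s n.
Proof.
move=> rs; have [i ri] : exists i, r i <> s i.
  by apply: contrapT => H; apply: rs; apply/funext => i;
    apply: contrapT => ri; apply: H; exists i.
have /nearP[N HN] := near_ge_values (fun k => (pickle (mkseq r k)).+1) i.+1.
apply/nearP; exists N => n Nn [k _ rk] [l _ sl].
have ik : (i < k)%N.
  by rewrite ltnNge; apply/negP => /(HN n Nn); rewrite rk ltnn.
move: rk; rewrite -sl => /(pcan_inj pickleK) e; apply: ri.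
have kl : k = l by rewrite -(size_mkseq r k) e size_mkseq.
by rewrite -(nth_mkseq false r ik) e nth_mkseq // -kl.
Qed.

Definition converges (S U : set nat) (x : nat) : Prop :=
  \forall z \near \oo, S z -> (U z <-> U x).

Lemma near_range (u : nat -> nat) (P : nat -> Prop) :
  (\forall i \near \oo, P (u i)) -> \forall z \near \oo, range u z -> P z.
Proof.
move=> /nearP[N HN]; have /nearP[M HM] := near_ge_values (fun i => (u i).+1) N.
apply/nearP; exists M => z Mz [i _ uiz]; rewrite -uiz; apply: HN.
by rewrite leqNgt; apply/negP => /(HM z Mz); rewrite uiz ltnn.
Qed.

Section sequential_closure.
Variable CC : set (set nat).
Hypothesis CC_bounded : forall F : set nat -> nat -> nat,
  exists g, forall W, CC W -> lt_mod_finite (F W) g.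

Definition seqlim (A : set nat) (x : nat) : Prop := exists u : nat -> nat,
  (forall i, [/\ A (u i), cong i x (u i) & (i <= u i)%N]) /\
  forall W, CC W -> \forall i \near \oo, W (u i) <-> W x.

(* Domination turns a limit of limits into a limit. *)
Lemma seqlim_idem (A S : set nat) (x : nat) (g : nat -> nat) :
  S `<=` funnel g x -> (forall W, CC W -> converges S W x) ->
  ~ seqlim A x -> \forall z \near \oo, S z -> ~ (A z \/ seqlim A z).
Proof.
move=> Sg SC nlim; apply: contrapT => H; apply: nlim.
have /choice[z zP] : forall i, exists z,
    [/\ S z, A z \/ seqlim A z, cong i x z & (i <= z)%N].
  move=> i; have /nearP[N HN] := funnel_cong g x i.
  have [z] := not_nearP H (maxn i N); rewrite geq_max => /andP[iz Nz] /not_implyP.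
  by case=> Sz /contrapT Az; exists z; split=> //; apply: HN => //; exact: Sg.
(* [v i] converges to [z i]; it is constant if [z i] is already in [A]. *)
have /choice[v vP] : forall i, exists v : nat -> nat,
    (forall l, (i <= l)%N -> [/\ A (v l), cong i (z i) (v l) & (i <= v l)%N]) /\
    forall W, CC W -> \forall l \near \oo, W (v l) <-> W (z i).
  move=> i; have [_ [Az|[v [vA vC]]] _ iz] := zP i.
    by exists (fun _ => z i); split=> [//|W _]; near=> l.
  exists v; split=> // l il; have [Av zv lv] := vA l; split=> //.
    exact: cong_le zv.
  exact: leq_trans lv.
(* [F W i] tells from where on [v i] has settled with respect to [W]; a common bound [f] selects the
   diagonal sequence. *)
have /choice[F FP] : forall W, exists f : nat -> nat, CC W ->
    forall i l, (f i <= l)%N -> (W (v i l) <-> W (z i)).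
  move=> W; have [CW|] := pselect (CC W); last by exists id.
  have /choice[f fP] : forall i, exists N, forall l, (N <= l)%N ->
      (W (v i l) <-> W (z i)).
    by move=> i; apply/nearP; have [_] := vP i; apply.
  by exists f.
have [f fP] := CC_bounded F.
exists (fun i => v i (maxn i (f i))); split=> [i|W CW].
  have [_ _ xz _] := zP i.
  have [Av zv iv] := (vP i).1 (maxn i (f i)) (leq_maxl _ _).
  by split=> //; apply: cong_trans xz zv.
have /nearP[N HN] := SC W CW; have /nearP[M HM] := fP W CW.
apply/nearP; exists (maxn N M) => i; rewrite geq_max => /andP[Ni Mi].
have [Sz _ _ iz] := zP i.
apply: iff_trans (HN _ (leq_trans Ni iz) Sz); apply: FP => //.
by apply: leq_trans (ltnW (HM _ Mi)) (leq_maxr _ _).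
Unshelve. all: by end_near. Qed.

(* The branches are almost disjoint; a promise may concentrate its columns on
   one of them only, which leaves the other ones free for avoiders. *)
Definition thin (r : nat -> bool) (S : set nat) : Prop :=
  forall s, s <> r -> forall phi : nat -> nat,
  \forall z \near \oo, S z -> branch s (col z) -> (phi (col z) <= z)%N.

Lemma thin_subsequence (A : set nat) (x : nat) : seqlim A x ->
  exists (v : nat -> nat) (r : nat -> bool),
    [/\ forall i, [/\ A (v i), cong i x (v i) & (i <= v i)%N],
        forall W, CC W -> \forall i \near \oo, W (v i) <-> W x &
        thin r (range v)].
Proof.
move=> [u [uP uC]].
have [[r rP]|no_r] := pselect (exists r, forall N, exists i,
    [/\ (N <= i)%N, (N <= col (u i))%N & branch r (col (u i))]).
  have /choice[i iP] := rP.
  exists (u \o i), r; split=> [j|W /uC /nearP[N HN]|s sr phi].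
  - have [ji _ _] := iP j; have [Au xu iu] := uP (i j).
    by split=> //=; [exact: cong_le xu|exact: leq_trans iu].
  - apply/nearP; exists N => j Nj; apply: HN.
    by have [ji _ _] := iP j; exact: leq_trans ji.
  - apply: near_range; have /nearP[N HN] := branch_disjoint sr.
    apply/nearP; exists N => j Nj /= sj; have [_ jc rj] := iP j.
    by have /(_ rj) := HN _ (leq_trans Nj jc) sj.
(* No branch is exceptional here, so the choice of [r] is arbitrary. *)
exists u, (fun _ => true); split=> // s _ phi.
have [N HN] : exists N, forall i, (N <= i)%N -> branch s (col (u i)) ->
    (col (u i) < N)%N.
  apply: contrapT => H; apply: no_r; exists s => N; apply: contrapT => HN.
  apply: H; exists N => i Ni si; rewrite ltnNge; apply/negP => Nc.
  by apply: HN; exists i.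
have H1 : \forall z \near \oo, range u z -> branch s (col z) -> (col z < N)%N.
  by apply: near_range; apply/nearP; exists N.
apply: filterS2 H1 (near_ge_values phi N) => z H1 H2 uz sz.
by apply: H2; exact: H1.
Qed.

End sequential_closure.

Record stage := Stage {
  promise : set nat;
  modulus : nat -> nat;
  exception : nat -> bool;
  separator : set nat;
  avoider : set nat }.

Section continuum_space.
Variables (b : Type) (R : b -> b -> Prop).
Hypothesis b_bound : is_bounding_number b.
Hypothesis Rwo : well_ordering R.
Hypothesis R_small : forall k, ~ ([set: b] #<= [set l | R l k]).
Variable q : nat -> nat -> nat -> nat.
Hypothesis qP : forall n x i,
  [/\ (i <= q n x i)%N, cong i x (q n x i) & col (q n x i) = n].
Variables (As : b -> set nat) (xs : b -> nat) (gs : b -> nat -> nat).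

Definition respects (h : b -> stage) (k : b) (U : set nat) : Prop :=
  (forall l, R l k -> converges (promise (h l)) U (xs l)) /\
  forall n x, converges (range (q n x)) U x.

(** A promise converges along the clopen sets of stages up to [k], and those of stage [k] respect
    earlier promises; so in the end every promise converges along every clopen set. *)
Definition valid (h : b -> stage) (k : b) (d : stage) : Prop :=
  [/\ promise d `<=` funnel (modulus d) (xs k) /\ thin (exception d) (promise d),
      (forall l, R l k -> converges (promise d) (separator (h l)) (xs k) /\
                          converges (promise d) (avoider (h l)) (xs k)) /\
      converges (promise d) (separator d) (xs k) /\
      converges (promise d) (avoider d) (xs k),
      respects h k (separator d) /\ respects h k (avoider d),
      [\/ As k (xs k),
          promise d `<=` As k /\ (forall N, exists2 z, (N <= z)%N & promise d z) |
          separator d (xs k) /\ forall z, As k z -> ~ separator d z] &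
      avoider d !=set0 /\ exists r, forall z, avoider d z ->
        branch r (col z) -> (gs k (col z) <= z)%N].

Lemma q_funnel (n x : nat) : range (q n x) `<=` funnel (fun i => (q n x i).+1) x.
Proof. by move=> _ [i _ <-]; exists i => //; have [] := qP n x i. Qed.

Section step.
Variables (h : b -> stage) (k : b).
Hypothesis hP : forall l, R l k -> valid h l (h l).

Lemma bounded_below (F : b -> nat -> nat) :
  exists g, forall l, R l k -> lt_mod_finite (F l) g.
Proof. exact: (bounded_small_family F b_bound (@R_small k)). Qed.

(** Fewer than b earlier moduli and countably many column sequences are dominated by one function,
    whose funnels feed [separation]. *)
Lemma separate_below (B : set nat) (x0 : nat) : ~ B x0 ->
  (forall l, R l k -> ~ B (xs l) ->
    \forall z \near \oo, promise (h l) z -> ~ B z) ->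
  (forall n x, ~ B x -> \forall z \near \oo, range (q n x) z -> ~ B z) ->
  exists U, [/\ U x0, forall z, B z -> ~ U z & respects h k U].
Proof.
move=> Bx0 Bh Bq; have [f1 f1P] := bounded_below (fun l => modulus (h l)).
have [f2 f2P] := bounded_countable_family (A := [set: nat * nat])
  (fun p i => (q p.1 p.2 i).+1) (countableP _).
have [U [Ux0 UB Uf]] := @separation (fun n => maxn (f1 n) (f2 n)) B x0 Bx0.
exists U; split=> //; split=> [l lk|n x].
  apply: Uf => [|nB]; last exact: Bh.
  have [[Sf _] _ _ _ _] := hP lk.
  apply: filterS (funnel_mod (xs l) (lt_mod_finite_maxl f2 (f1P l lk))).
  by move=> z fz /Sf.
apply: Uf => [|nB]; last exact: Bq.
apply: filterS (funnel_mod x (lt_mod_finite_maxr f1 (f2P (n, x) I))).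
by move=> z fz /q_funnel.
Qed.

(** The earlier stages are too few to use up all branches as exceptions. On a fresh branch [r],
    thinness makes every earlier promise almost miss the points below [gs k]. *)
Lemma avoider_exists : exists V, [/\ V !=set0, respects h k V &
  exists r, forall z, V z -> branch r (col z) -> (gs k (col z) <= z)%N].
Proof.
have [r rP] : exists r, forall l, R l k -> r <> exception (h l).
  apply: contrapT => H; apply: (@R_small k).
  apply: (@card_le_trans _ _ _ [set: nat -> bool]).
    have [[Fam _ /card_eqPle[_ bF]] _] := b_bound.
    apply: card_le_trans bF _; apply: card_le_trans (card_leT Fam) _.
    apply: card_le_trans card_nat_functions_le.
    by apply/card_le_injP; exists (fun g => (set0, 0%N, g)) => g g' [].
  apply/card_le_setP.
  have /choice[e eP] : forall r, exists l, R l k /\ r = exception (h l).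
    move=> r; apply: contrapT => Hr; apply: H; exists r => l lk rl.
    by apply: Hr; exists l.
  exists e => [r s e_rs|r]; last exact: (eP r).1.
  by rewrite (eP r).2 (eP s).2 e_rs.
pose B := [set z | branch r (col z) /\ (z < gs k (col z))%N].
have [x0 [x0_ge _ x0_col]] := col_dense 0 0 (gs k 0).
have [|l lk _|n x _|V [Vx0 VB Vh]] := @separate_below B x0.
- by move=> [_]; rewrite x0_col ltnNge x0_ge.
- have [[_ thin_l] _ _ _ _] := hP lk.
  apply: filterS (thin_l r (rP l lk) (gs k)) => z H Sz [rz].
  by rewrite ltnNge H.
- apply/nearP; exists (gs k n) => z nz [i _ qz] [_].
  have -> : col z = n by rewrite -qz; have [] := qP n x i.
  by rewrite ltnNge nz.
exists V; split=> //; first by exists x0.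
exists r => z Vz rz; rewrite leqNgt; apply/negP => zg.
exact: (VB z).
Qed.

Lemma stage_exists : exists d, valid h k d.
Proof.
have [V [V0 Vh Vr]] := avoider_exists.
pose CC := [set W | W = V \/ exists2 l, R l k &
  W = separator (h l) \/ W = avoider (h l)].
have CC_bounded (F : set nat -> nat -> nat) :
    exists g, forall W, CC W -> lt_mod_finite (F W) g.
  have [g1 g1P] := bounded_below (fun l => F (separator (h l))).
  have [g2 g2P] := bounded_below (fun l => F (avoider (h l))).
  exists (fun n => maxn (maxn (g1 n) (g2 n)) (F V n).+1) => W [->|[l lk [->|->]]].
  - by apply: lt_mod_finite_maxr; near=> n.
  - by apply/lt_mod_finite_maxl/lt_mod_finite_maxl/g1P.
  - by apply/lt_mod_finite_maxl/lt_mod_finite_maxr/g2P.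
have set0P S x : converges S set0 x by near=> z.
have respects0 : respects h k set0 by [].
have [Ax|nAx] := pselect (As k (xs k)).
  exists (Stage set0 id (fun _ => true) set0 V); split=> //=.
  - by split=> // s _ phi; near=> z.
  - by split=> [l lk|]; split; near=> z.
  - by constructor 1.
have [|nlim] := pselect (seqlim CC (As k) (xs k)).
  move=> /thin_subsequence[v [r [vP vC v_thin]]].
  have v_conv W : CC W -> converges (range v) W (xs k).
    by move=> /vC; exact: (near_range (P := fun z => W z <-> W (xs k))).
  exists (Stage (range v) (fun i => (v i).+1) r set0 V); split=> //=.
  - split=> // _ [i _ <-]; exists i => //.
    by have [] := vP i.
  - split=> [l lk|]; last by split=> //; apply: v_conv; left.
    by split; apply: v_conv; right; exists l => //; [left|right].
  - constructor 2; split; first by move=> _ [i _ <-]; have [] := vP i.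
    by move=> N; exists (v N); [have [] := vP N|exists N].
(* Adding the sequential limits to [As k] makes the set sequentially closed, so that promises to
   points outside it almost avoid it. *)
pose B := [set z | As k z \/ seqlim CC (As k) z].
have [|l lk nB|n x nB|U [Ux UB Uh]] := @separate_below B (xs k).
- by case.
- have [[Sf _] [Sconv [Sconv1 Sconv2]] _ _ _] := hP lk.
  apply: (seqlim_idem CC_bounded Sf) => [W|lim]; last by apply: nB; right.
  have [_ Rtri _] := Rwo.
  case=> [->|[m mk Wm]]; first exact: Vh.1.
  (* The promise of stage [l] converges along the sets of stages up to [l] by its own validity, and
     along later ones because they respect it. *)
  have [ml|ml|lm] := Rtri m l.
  + by case: Wm => ->; have [] := Sconv m ml.
  + by case: Wm => ->; rewrite ml.
  + have [_ _ [[Us _] [Us' _]] _ _] := hP mk.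
    by case: Wm => ->; [exact: Us|exact: Us'].
- apply: (seqlim_idem CC_bounded (@q_funnel n x)) => [W|lim]; last by apply: nB; right.
  case=> [->|[m mk Wm]]; first exact: Vh.2.
  have [_ _ [[_ Uq] [_ Uq']] _ _] := hP mk.
  by case: Wm => ->; [exact: Uq|exact: Uq'].
exists (Stage set0 id (fun _ => true) U V); split=> //=.
- by split=> // s _ phi; near=> z.
- by split=> [l lk|]; split; near=> z.
- by constructor 3; split=> // z Az; apply: UB; left.
Unshelve. all: by end_near. Qed.

End step.

Lemma stages_exist : exists h, forall k, valid h k (h k).
Proof.
have [Rwf _ _] := Rwo.
apply: (wf_dependent_choice (P := valid)
  (Stage set0 id (fun _ => true) set0 set0) Rwf); last exact: stage_exists.
move=> h h' k d hh' [d1 [d2 d3] [[d4 d5] [d6 d7]] d8 d9]; split=> //.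
  by split=> // l lk; rewrite -hh' //; exact: d2.
by split; split=> // l lk; rewrite -hh' //; [exact: d4|exact: d6].
Qed.

End continuum_space.

Lemma continuum_segments_space (b : Type) (R : b -> b -> Prop) :
  is_bounding_number b -> well_ordering R ->
  (forall k, ~ ([set: b] #<= [set l | R l k])) ->
  [set: nat -> bool] #<= [set: b] ->
  frechet_urysohn_example.
Proof.
move=> b_bound Rwo R_small cb.
have [q qP] := col_sequence.
have all_b := card_le_trans card_nat_functions_le cb.
(* Bookkeeping: since c is at most b, every set, point and function is treated at some stage. *)
have [en en_surj] : exists en : b -> set nat * nat * (nat -> nat),
    forall p, exists k, en k = p.
  by have /card_le_injP[f /(inj_surj (set0, 0%N, id))] := all_b.
pose As k := (en k).1.1; pose xs k := (en k).1.2; pose gs k := (en k).2.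
have [h hP] := @stages_exist b R b_bound Rwo R_small q qP As xs gs.
pose C (p : b * bool) := if p.2 then separator (h p.1) else avoider (h p.1).
have Cq p n x : converges (range (q n x)) (C p) x.
  case: p => k c; have [_ _ [[_ Uq] [_ Vq]] _ _] := hP k.
  by case: c; [exact: Uq|exact: Vq].
have CS p k : converges (promise (h k)) (C p) (xs k).
  case: p => l c; have [_ Rtri _] := Rwo.
  have [_ [Sl Sk] _ _ _] := hP k; rewrite /C /=.
  have [lk|->|kl] := Rtri l k.
  - by have [] := Sl l lk; case: c.
  - by have [] := Sk; case: c.
  - by have [_ _ [[Us _] [Vs _]] _ _] := hP l; case: c; [exact: Us|exact: Vs].
apply: (@cell_space_spec (b * bool) b C) => //.
- move=> n s x; have /nearP[N HN] : \forall i \near \oo, cell C s x (q n x i).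
    apply: near_cell => [i|p]; first by have [] := qP n x i.
    have /nearP[N HN] := Cq p n x; apply/nearP; exists N => i Ni.
    by apply: HN; [have [iq _ _] := qP n x i; exact: leq_trans iq|exists i].
  by exists (q n x N); [have [] := qP n x N|exact: HN].
- move=> A x clA nAx; have [k kE] := en_surj (A, x, id).
  have As_k : As k = A by rewrite /As kE.
  have xs_k : xs k = x by rewrite /xs kE.
  have [[Sf _] _ _ + _] := hP k; rewrite As_k xs_k => -[//|[SA S_unb]|[Ux UA]].
    have /choice[u uP] : forall i, exists z,
        [/\ promise (h k) z, cong i x z & (i <= z)%N].
      move=> i; have /nearP[N HN] := funnel_cong (modulus (h k)) x i.
      have [z] := S_unb (maxn i N); rewrite geq_max => /andP[iz Nz] Sz.
      by exists z; split=> //; apply: HN => //; rewrite -xs_k; exact: Sf.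
    exists u => [i|]; first by apply: SA; have [] := uP i.
    apply: near_cell => [i|p]; first by have [] := uP i.
    have /nearP[N HN] := CS p k; apply/nearP; exists N => i Ni.
    have [Su _ iu] := uP i; rewrite -xs_k; apply: HN => //.
    exact: leq_trans iu.
  (* A separator containing [x] and missing [A] would contradict that [x] is in the closure of
     [A]. *)
  have [y Ay [_ H]] := clA (0%N, [:: (k, true)]).
  by case: (UA y Ay); apply/(List.Forall_inv H).
- move=> g; have [k kE] := en_surj (set0, 0%N, g).
  have [_ _ _ _ [V0 [r rP]]] := hP k.
  exists (k, false), (branch r); split=> //.
    by apply: unbounded_infinite => N; exact: branch_unbounded.
  by move=> y Vy /(rP y Vy); rewrite /gs kE.
(* Cells are subsets of [nat], so there are at most c of them. *)
- apply: card_le_trans (card_leT _) _; apply: card_le_trans all_b.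
  by apply/card_le_injP; exists (fun A => (A, 0%N, id)) => A B [].
Qed.

(** * The dichotomy for b when c is at most omega_2 *)

Unset Implicit Arguments.

Theorem corollary4 (omega1 omega2 : Type)
    (h1 : is_successor_cardinal nat omega1)
    (h2 : is_successor_cardinal omega1 omega2)
    (hc : [set: nat -> bool] #<= [set: omega2]) :
  exists X : topologicalType,
    [/\ countable [set: X],
        hausdorff_space X,
        has_clopen_base X,
        frechet_urysohn X &
        ~ H_separable X /\
        exists b : Type, is_bounding_number b /\ is_pi_weight X b].
Proof.
have [b b_bound] := bounding_number_exists.
have [R [Rwo R_small]] := initial_well_ordering b.
have [b1|b1] := pselect ([set: b] #<= [set: omega1]).
  apply: (countable_segments_space b_bound Rwo) => k.
  (* An uncountable segment would have size at least omega_1, hence at least b. *)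
  apply: contrapT => segk; apply: (R_small k); apply: card_le_trans b1 _.
  have /card_eqPle[seg_le le_seg] := card_setT [set l | R l k].
  apply: card_le_trans (h1.2 (set_type [set l | R l k]) _) seg_le.
  have nseg : ~ ([set: set_type [set l | R l k]] #<= [set: nat]).
    by move=> H; apply: segk; exact: card_le_trans le_seg H.
  by split=> //; case: (card_le_total nat (set_type [set l | R l k])).
(* Now b exceeds omega_1, so it is at least omega_2 and therefore at least c. *)
apply: (continuum_segments_space b_bound Rwo R_small).
apply: card_le_trans hc (h2.2 b _); split=> //.
by case: (card_le_total omega1 b).
Qed.
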